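(* Let $(X_n)_{n\in\mathbb{Z}_+}$ be an inhomogeneous INAR(1) process with offspring means $\varrho_n=\mathsf{E}\xi_{n,1}$ and immigration variables $\varepsilon_n$. Write $m_{n,1}=\mathsf{E}\varepsilon_n$ and $m_{n,2}=\mathsf{E}\varepsilon_n(\varepsilon_n-1)$. Assume that (i) $\varrho_n<1$ for all $n\in\mathbb{N}$, $\lim_{n\to\infty}\varrho_n=1$, and $\sum_{n=1}^\infty(1-\varrho_n)=\infty$; (ii) $\lim_{n\to\infty}\frac{m_{n,1}}{1-\varrho_n}=\lambda\in[0,\infty)$ and $\lim_{n\to\infty}\frac{m_{n,2}}{1-\varrho_n}=0$. Then $X_n$ converges in distribution to the Poisson distribution $\mathrm{Po}(\lambda)$ as $n\to\infty$.
   Context: An inhomogeneous INAR(1) process $(X_n)_{n\in\mathbb{Z}_+}$ is defined by $X_0=0$ and $X_n=\sum_{j=1}^{X_{n-1}}\xi_{n,j}+\varepsilon_n$ for $n\in\mathbb{N}$, where $\{\xi_{n,j},\varepsilon_n:n,j\in\mathbb{N}\}$ are independent non-negative integer-valued random variables such that, for each $n\in\mathbb{N}$, the variables $\{\xi_{n,j}:j\in\mathbb{N}\}$ are identically distributed and $\mathsf{P}(\xi_{n,1}\in\{0,1\})=1$. The offspring means are $\varrho_n:=\mathsf{E}\xi_{n,1}\in[0,1]$. $\mathrm{Po}(\lambda)$ is the Poisson distribution with mean $\lambda$; $\mathrm{Po}(0)$ is the Dirac measure concentrated at $0$. *)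

(* Defs.v *)
From HB Require Import structures.
From mathcomp Require Export all_boot all_order all_algebra.
From mathcomp Require Export all_classical all_reals all_analysis.

Set Implicit Arguments.
Unset Strict Implicit.
Unset Printing Implicit Defensive.

Import Order.TTheory GRing.Theory Num.Theory.
Import numFieldNormedType.Exports.

Local Open Scope classical_set_scope.
Local Open Scope ring_scope.

Definition natR (R : realType) (k : nat) : R := k%:R.

Lemma measurable_natR (R : realType) : measurable_fun [set: nat] (@natR R).
Proof. by []. Qed.

HB.instance Definition _ (R : realType) :=
  isMeasurableFun.Build _ _ _ _ (@natR R) (@measurable_natR R).

Definition mutually_independent (R : realType) (d : measure_display)
    (T : measurableType d) (P : probability T R) (d' : measure_display)
    (T' : measurableType d') (I : eqType) (D : set I)
    (Y : I -> {RV P >-> T'}) : Prop :=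
  forall (s : seq I) (B : I -> set T'),
    uniq s -> (forall i, i \in s -> D i) ->
    (forall i, i \in s -> measurable (B i)) ->
    P (\bigcap_(i in [set` s]) (Y i @^-1` B i)) =
      (\prod_(i <- s) P (Y i @^-1` B i))%E.
Arguments mutually_independent {R d T} P {d' T' I} D Y.

Definition identically_distributed (R : realType) (d : measure_display)
    (T : measurableType d) (P : probability T R) (d' : measure_display)
    (T' : measurableType d') (Y Z : {RV P >-> T'}) : Prop :=
  forall B : set T', measurable B -> distribution P Y B = distribution P Z B.
Arguments identically_distributed {R d T} P {d' T'} Y Z.

Definition cvg_in_distribution (R : realType) (d : measure_display)
    (T : measurableType d) (P : probability T R) (Y : nat -> {RV P >-> R})
    (mu : probability R R) : Prop :=
  forall f : R -> R, continuous f -> bounded_fun f ->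
    (\int[distribution P (Y n)]_x (f x)%:E)%E @[n --> \oo]
      --> (\int[mu]_x (f x)%:E)%E.
Arguments cvg_in_distribution {R d T} P Y mu.

(* The library's poisson_prob is a measure on nat, equal to the Dirac measure
   at 0 when the rate is 0; its second argument is ignored. *)
Definition poissonR (R : realType) (lambda : R) : probability R R :=
  distribution (poisson_prob lambda 0%N) (natR R).

(* inl (n, j) stands for xi_{n,j} and inr n for eps_n. *)
Definition inar_family (R : realType) (d : measure_display)
    (T : measurableType d) (P : probability T R)
    (xi : nat -> nat -> {RV P >-> nat}) (eps : nat -> {RV P >-> nat})
    (i : nat * nat + nat) : {RV P >-> nat} :=
  match i with
  | inl (n, j) => xi n j
  | inr n => eps n
  end.
Arguments inar_family {R d T} P xi eps i.

Definition inar_index : set (nat * nat + nat) :=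
  [set i | match i with
           | inl (n, j) => (0 < n)%N && (0 < j)%N
           | inr n => (0 < n)%N
           end].

(* Indices of xi and eps start at 1: the values xi 0 j, xi n 0 and eps 0 are
   unconstrained. *)
Record inhomogeneous_INAR1 (R : realType) (d : measure_display)
    (T : measurableType d) (P : probability T R)
    (xi : nat -> nat -> {RV P >-> nat}) (eps : nat -> {RV P >-> nat})
    (X : nat -> {RV P >-> nat}) : Prop := {
  inar_independent : mutually_independent P inar_index (inar_family P xi eps) ;
  inar_identical : forall n j : nat, (0 < n)%N -> (0 < j)%N ->
    identically_distributed P (xi n j) (xi n 1%N) ;
  inar_bernoulli : forall n : nat, (0 < n)%N ->
    P (xi n 1%N @^-1` [set 0%N; 1%N]) = 1%E ;
  inar_init : forall t : T, X 0%N t = 0%N ;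
  inar_step : forall (n : nat) (t : T), (0 < n)%N ->
    X n t = ((\sum_(1 <= j < (X n.-1 t).+1) xi n j t) + eps n t)%N }.
Arguments inhomogeneous_INAR1 {R d T} P xi eps X.

Definition offspring_mean (R : realType) (d : measure_display)
    (T : measurableType d) (P : probability T R)
    (xi : nat -> nat -> {RV P >-> nat}) (n : nat) : \bar R :=
  ('E_P[natR R \o xi n 1%N])%E.
Arguments offspring_mean {R d T} P xi n.

(* Main.v *)
Require Import Defs.
From mathcomp Require Import all_boot all_order all_algebra.
From mathcomp Require Import all_classical all_reals all_analysis.
From mathcomp Require Import measurable_realfun zify ring lra.
Import Order.TTheory GRing.Theory Num.Theory.
Import numFieldNormedType.Exports.
Local Open Scope classical_set_scope.
Local Open Scope ring_scope.
Local Open Scope ereal_scope.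

(** With H_n(s) = E (1 - s)^X_n and K_n(s) = E (1 - s)^eps_n, Bernoulli thinning
    and independence give H_n(s) = H_(n-1)(rho_n s) K_n(s), and the moment
    assumptions give |K_n(s) - exp(- lambda (1 - rho_n) s)| <=
    s (1 - rho_n) delta_n with delta_n -> 0.  Since s |-> exp(- lambda s)
    satisfies the same recursion with K_n(s) replaced by
    exp(- lambda (1 - rho_n) s), the error D_n(s) = H_n(s) - exp(- lambda s)
    satisfies |D_n(s)| <= |D_(n-1)(rho_n s)| + s (1 - rho_n) delta_n.  If
    delta_k <= e for all k > N, iterating yields
    |D_n(s)| <= |D_N(rho_(N+1) ... rho_n s)| + e s, and the product tends to 0
    because the sum of the 1 - rho_k diverges; starting at N rather than at 0
    also avoids moments of the first immigrations, which may be infinite.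
    Convergence of generating functions on [0, 1] gives convergence of the point
    masses, hence of the expectations of bounded functions. *)

(** * Weights independent of a family of integer variables *)

Section independent_weights.
Local Set Implicit Arguments.
Local Unset Strict Implicit.
Context {R : realType} {d : measure_display} {T : measurableType d}.
Variable P : probability T R.

Lemma measurable_preimage_nat (Z : {RV P >-> nat}) (B : set nat) :
  measurable (Z @^-1` B).
Proof. by rewrite -[X in measurable X]setTI; exact: measurable_funP. Qed.

Lemma bigcup_preimage_nat (Z : T -> nat) (D : set T) :
  \bigcup_b (D `&` Z @^-1` [set b]) = D.
Proof.
by apply/seteqP; split=> [x [b _ []]//|x Dx]; exists (Z x).
Qed.

Lemma measurable_fun_select (Z : {RV P >-> nat}) (F : nat -> T -> \bar R) :
  (forall b, measurable_fun setT (F b)) ->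
  measurable_fun setT (fun x => F (Z x) x).
Proof.
move=> mF; rewrite -(bigcup_preimage_nat Z setT).
have mZ b : measurable (setT `&` Z @^-1` [set b]).
  by rewrite setTI; exact: measurable_preimage_nat.
apply/measurable_fun_bigcup => // b.
apply: (eq_measurable_fun (F b)) => [x|].
  by rewrite inE => -[_ /= ->].
exact: measurable_funS (mF b).
Qed.

(** The level sets of [Z] form a countable partition, so a random index [Z x] is traded for fixed
    ones; this is how the random number of summands is handled. *)
Lemma ge0_integral_select (Z : {RV P >-> nat}) (F : nat -> T -> \bar R)
    (D : set T) : measurable D ->
  (forall b, measurable_fun setT (F b)) -> (forall b x, 0 <= F b x) ->
  \int[P]_(x in D) F (Z x) x =
  \sum_(b <oo) \int[P]_(x in D `&` Z @^-1` [set b]) F b x.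
Proof.
move=> mD mF F0; rewrite -[X in integral _ X](bigcup_preimage_nat Z D).
rewrite ge0_integral_bigcup//.
- apply: eq_eseriesr => b _; apply: eq_integral => x.
  by rewrite inE => -[_ /= ->].
- by move=> b; apply: measurableI => //; exact: measurable_preimage_nat.
- by apply: measurable_funS (measurable_fun_select Z mF).
- by move=> i j _ _ [x [[_ /= <-] [_ /= <-]]].
Qed.

Context {I : eqType} (Y : I -> {RV P >-> nat}).

Definition cylinder (s : seq I) (B : I -> set nat) : set T :=
  \bigcap_(i in [set` s]) (Y i @^-1` B i).

Lemma cylinder_nil (B : I -> set nat) : cylinder [::] B = setT.
Proof. by apply/seteqP; split=> // x _ i /=; rewrite in_nil. Qed.

Lemma measurable_cylinder s B : measurable (cylinder s B).
Proof.
elim: s => [|i s IHs]; first by rewrite cylinder_nil.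
rewrite [cylinder _ _](_ : _ = Y i @^-1` B i `&` cylinder s B).
  by apply: measurableI => //; exact: measurable_preimage_nat.
apply/seteqP; split=> [x Bx|x [Bi Bs] k /=]; last first.
  by rewrite inE => /orP[/eqP->//|]; exact: Bs.
split=> [|k ks]; first by apply: Bx; rewrite /= mem_head.
by apply: Bx; rewrite /= inE; apply/orP; right.
Qed.

Lemma cylinder_cons i s B b : i \notin s ->
  cylinder s B `&` Y i @^-1` [set b] =
  cylinder (i :: s) (fun k => if k == i then [set b] else B k).
Proof.
move=> iNs; apply/seteqP; split=> [x [Bx ib] k|x Bx].
  rewrite /= inE; case: eqP => [->//|_ /= ks]; exact: Bx.
split=> [k /= ks|].
  have := Bx k; rewrite /= inE ks orbT => /(_ isT).
  by case: eqP ks iNs => // -> ->.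
by have := Bx i; rewrite /= inE eqxx => /(_ isT).
Qed.

(* The density W is independent of the family (Y i) for i in J: under the
   measure W dP that family is independent with its law under P, up to mass. *)
Definition indep_weight (J : set I) (W : T -> \bar R) : Prop :=
  [/\ measurable_fun setT W, (forall x, 0 <= W x) &
    forall s B, uniq s -> (forall i, i \in s -> J i) ->
      \int[P]_(x in cylinder s B) W x =
      (\int[P]_x W x) * \prod_(i <- s) P (Y i @^-1` B i)].

Lemma indep_weight_sub J J' W : J' `<=` J ->
  indep_weight J W -> indep_weight J' W.
Proof.
by move=> sub [mW W0 HW]; split=> // s B us sJ; apply: HW => // i /sJ /sub.
Qed.

Lemma indep_weight_cst J (c : R) : (0 <= c)%R ->
  mutually_independent P J Y -> indep_weight J (cst c%:E).
Proof.
move=> c0 indY; split=> // s B us sJ.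
rewrite !integral_cst//; last exact: measurable_cylinder.
by rewrite /= probability_setT mule1 /cylinder indY.
Qed.

Lemma prod_probability_fin_num (s : seq I) (B : I -> set nat) :
  \prod_(i <- s) P (Y i @^-1` B i) \is a fin_num.
Proof.
apply: (big_ind (fun x => x \is a fin_num)) => // [x y|i _]; first exact: fin_numM.
by apply: fin_num_measure; exact: measurable_preimage_nat.
Qed.

Lemma ge0_nneseriesZr (f : nat -> \bar R) (c : \bar R) : c \is a fin_num ->
  (forall i, 0 <= f i) ->
  \sum_(i <oo) (f i * c) = (\sum_(i <oo) f i) * c.
Proof.
move=> /fineK <- f0; rewrite muleC -nneseriesZl//.
by apply: eq_eseriesr => i _; rewrite muleC.
Qed.

Section mixing.
Variables (J : set I) (F : nat -> T -> \bar R) (i : I).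
Hypotheses (indF : forall b, indep_weight J (F b)) (Ji : J i).

Let mF b : measurable_fun setT (F b). Proof. by case: (indF b). Qed.
Let F0 b x : 0 <= F b x. Proof. by case: (indF b). Qed.

Let integral_cylinder_mix s B : uniq s -> (forall k, k \in s -> J k /\ k <> i) ->
  \int[P]_(x in cylinder s B) F (Y i x) x =
  (\sum_(b <oo) (\int[P]_x F b x * P (Y i @^-1` [set b]))) *
  \prod_(k <- s) P (Y k @^-1` B k).
Proof.
move=> us sJ; have iNs : i \notin s by apply/negP => /sJ[].
rewrite ge0_integral_select//; last exact: measurable_cylinder.
rewrite -ge0_nneseriesZr; [|exact: prod_probability_fin_num|]; last first.
  by move=> b; apply: mule_ge0 => //; exact: integral_ge0.
apply: eq_eseriesr => b _.
rewrite cylinder_cons//; have [_ _ ->] := indF b.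
- rewrite big_cons eqxx muleA; congr (_ * _).
  rewrite !big_seq; apply: eq_bigr => k ks.
  by case: eqP ks iNs => // -> ->.
- by rewrite /= iNs.
- by move=> k; rewrite inE => /orP[/eqP->//|/sJ[]].
Qed.

Lemma integral_mix : \int[P]_x F (Y i x) x =
  \sum_(b <oo) (\int[P]_x F b x * P (Y i @^-1` [set b])).
Proof.
have := @integral_cylinder_mix [::] (fun=> setT) isT.
by rewrite cylinder_nil big_nil mule1; exact.
Qed.

(** For each [b] the event [Y i = b] is one more cylinder coordinate, which factors out of [F b].
    The index [i] is then spent and leaves [J]. *)
Lemma indep_weight_mix : indep_weight (J `\ i) (fun x => F (Y i x) x).
Proof.
split=> [|x//|s B us sJ]; first exact: measurable_fun_select.
by rewrite integral_cylinder_mix// integral_mix.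
Qed.

End mixing.

(** Here [Z] need not be one of the [Y i], so independence is asked of each [F l] cut down to
    [Z = l]; the product over the cylinder is a common factor of the pieces. *)
Lemma indep_weight_select J (Z : {RV P >-> nat}) (F : nat -> T -> \bar R) :
  (forall l, measurable_fun setT (F l)) -> (forall l x, 0 <= F l x) ->
  (forall l, indep_weight J (F l \_ (Z @^-1` [set l]))) ->
  indep_weight J (fun x => F (Z x) x).
Proof.
move=> mF F0 indF; split=> [|x//|s B us sJ]; first exact: measurable_fun_select.
rewrite !ge0_integral_select//; last exact: measurable_cylinder.
rewrite -ge0_nneseriesZr; [|exact: prod_probability_fin_num|]; last first.
  by move=> b; exact: integral_ge0.
apply: eq_eseriesr => l _; rewrite setTI integral_mkcondr.
by have [_ _ ->//] := indF l; rewrite -integral_mkcond.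
Qed.

Lemma integral_indep_weightM J (W : T -> \bar R) (g : nat -> R) i :
  (forall b, (0 <= g b)%R) -> indep_weight J W -> \int[P]_x W x \is a fin_num ->
  J i -> \int[P]_x (W x * (g (Y i x))%:E) = \int[P]_x W x * \int[P]_x (g (Y i x))%:E.
Proof.
move=> g0 [mW W0 indW] fW Ji.
have g0' b : 0 <= (g b)%:E by rewrite lee_fin.
rewrite (@ge0_integral_select (Y i) (fun b x => W x * (g b)%:E))//; first last.
- by move=> b x; apply: mule_ge0.
- by move=> b; apply: emeasurable_funM.
rewrite (@ge0_integral_select (Y i) (fun b x => (g b)%:E))//.
rewrite -(fineK fW) -nneseriesZl; last by move=> b _; exact: integral_ge0.
apply: eq_eseriesr => b _; rewrite fineK// setTI integral_cst; last first.
  exact: measurable_preimage_nat.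
rewrite ge0_integralZr//; last 2 first.
- exact: measurable_preimage_nat.
- exact: measurable_funS mW.
have := indW [:: i] (fun=> [set b]) isT.
rewrite big_seq1 /cylinder (_ : [set` [:: i]] = [set i]); last first.
  by apply/seteqP; split=> k /=; rewrite inE => /eqP.
rewrite bigcap_set1 => ->; last by move=> k; rewrite inE => /eqP->.
by rewrite -muleA; congr (_ * _); rewrite muleC.
Qed.

End independent_weights.

(** * Generating functions of the INAR(1) process *)

Section inar_pgf.
Local Set Implicit Arguments.
Local Unset Strict Implicit.
Context {R : realType} {d : measure_display} {T : measurableType d}.
Context {P : probability T R}.
Context {xi : nat -> nat -> {RV P >-> nat}} {eps : nat -> {RV P >-> nat}}.
Context {X : nat -> {RV P >-> nat}}.
Hypothesis hX : inhomogeneous_INAR1 P xi eps X.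

Let Y := inar_family P xi eps.

(* Indices of the variables still unused once X n and
   xi n.+1 1, ..., xi n.+1 j have been revealed. *)
Definition future (n j : nat) : set (nat * nat + nat) :=
  [set i | match i with
           | inl (m, k) => ((n.+1 < m) || (m == n.+1) && (j < k)) && (0 < k)
           | inr m => n < m
           end%N].

(** The number [j] of parents is deterministic, so that offspring can be revealed one at a time;
    [inar_succ] then takes [j = X n x]. *)
Definition partial_offspring (n j : nat) (x : T) : nat :=
  (\sum_(1 <= i < j.+1) xi n.+1 i x)%N.

Lemma partial_offspringS n j x :
  partial_offspring n j.+1 x = (partial_offspring n j x + xi n.+1 j.+1 x)%N.
Proof. by rewrite /partial_offspring big_nat_recr. Qed.

Lemma inar_succ n x :
  X n.+1 x = (partial_offspring n (X n x) x + eps n.+1 x)%N.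
Proof. by rewrite (inar_step hX). Qed.

Definition past_independent n := forall g : nat -> R,
  (forall k, 0 <= g k)%R -> indep_weight Y (future n 0) (fun x => (g (X n x))%:E).

(** Each induction step reveals [xi n.+1 j.+1] and mixes over its value. Keeping [X n] as a separate
    argument of [g] allows restricting to [X n = l] later. *)
Lemma indep_weight_partial_offspring n j (g : nat -> nat -> R) :
  past_independent n -> (forall a v, 0 <= g a v)%R ->
  indep_weight Y (future n j)
    (fun x => (g (X n x) (partial_offspring n j x))%:E).
Proof.
move=> indX; elim: j g => [|j IHj] g g0.
  have := indX (g ^~ 0%N) (g0 ^~ 0%N).
  by congr indep_weight; apply/funext => x; rewrite /partial_offspring big_geq.
have := @indep_weight_mix _ _ _ P _ Y (future n j)
  (fun b x => (g (X n x) (partial_offspring n j x + b)%N)%:E) (inl (n.+1, j.+1)).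
have -> : (fun x => (g (X n x) (partial_offspring n j.+1 x))%:E) =
  (fun x => (g (X n x) (partial_offspring n j x + xi n.+1 j.+1 x)%N)%:E).
  by apply/funext => x; rewrite partial_offspringS.
move=> /(_ _ _)/indep_weight_sub; apply.
- case=> [[m k]|m] /=; last by move=> ?; split.
  move=> /andP[mk k0]; split.
    rewrite k0 andbT; case/orP: mk => [->//|/andP[-> jk]].
    by rewrite (ltnW jk) orbT.
  by case=> mn kj; move: mk; rewrite mn kj !ltnn eqxx.
- by move=> b; apply: (IHj (fun a v => g a (v + b)%N)) => a v.
- by rewrite /= eqxx ltnS leqnn ltnn.
Qed.

Lemma indep_weight_inar_step n j (g : nat -> nat -> R) :
  past_independent n -> (forall a v, 0 <= g a v)%R ->
  indep_weight Y (future n.+1 0)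
    (fun x => (g (X n x) (partial_offspring n j x + eps n.+1 x)%N)%:E).
Proof.
move=> indX g0.
have := @indep_weight_mix _ _ _ P _ Y (future n j)
  (fun b x => (g (X n x) (partial_offspring n j x + b)%N)%:E) (inr n.+1).
move=> /(_ _ _)/indep_weight_sub; apply.
- case=> [[m k]|m] /=.
    move=> /andP[mk k0]; split => //; rewrite k0 andbT.
    by move: mk; rewrite k0 andbT => /orP[/ltnW->//|/eqP->]; rewrite ltnSn.
  move=> nm; split; first exact: ltnW.
  by case=> mn; move: nm; rewrite mn ltnn.
- move=> b.
  exact: (@indep_weight_partial_offspring n j (fun a v => g a (v + b)%N)).
- by rewrite /=.
Qed.

Lemma patch_EFin_indic (f : T -> R) (Z : T -> nat) l :
  (fun x => (f x)%:E) \_ (Z @^-1` [set l]) = (fun x => ((Z x == l)%:R * f x)%:E).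
Proof.
apply/funext => x; rewrite /patch; case: eqP => [Zl|Zl].
  by rewrite mem_set//= mul1r.
by rewrite memNset// mul0r.
Qed.

Lemma inar_past_independent n : past_independent n.
Proof.
elim: n => [|n IHn] g g0.
  rewrite (_ : (fun x => _) = cst (g 0%N)%:E); last first.
    by apply/funext => x; rewrite (inar_init hX).
  apply: indep_weight_cst => //.
  move=> s B us sJ mB; apply: (inar_independent hX) => // i /sJ.
  (* [future 0 0] contains only indices starting at 1, where independence is assumed. *)
  case: i => [[m k]|m] //= /andP[mk ->]; rewrite andbT.
  by move: mk => /orP[/ltnW|/andP[/eqP->]].
have -> : (fun x => (g (X n.+1 x))%:E) =
  (fun x => (g (partial_offspring n (X n x) x + eps n.+1 x)%N)%:E).
  by apply/funext => x; rewrite inar_succ.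
apply: (@indep_weight_select _ _ _ P _ Y (future n.+1 0) (X n)
  (fun l x => (g (partial_offspring n l x + eps n.+1 x)%N)%:E)).
- by move=> l; case: (@indep_weight_inar_step n l (fun=> g) IHn).
- by move=> l x; rewrite lee_fin.
(* Restricting to [X n = l] multiplies the test function by the indicator of [a = l], so the case of
   a fixed number of parents applies. *)
- move=> l; rewrite patch_EFin_indic.
  apply: (@indep_weight_inar_step n l (fun a v => (a == l)%:R * g v)%R IHn).
  by move=> a v; rewrite mulr_ge0.
Qed.

Lemma integral_identically_distributed (Z Z' : {RV P >-> nat}) (g : nat -> R) :
  identically_distributed P Z Z' -> (forall k, 0 <= g k)%R ->
  \int[P]_x (g (Z x))%:E = \int[P]_x (g (Z' x))%:E.
Proof.
move=> ZZ' g0.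
have H (W : {RV P >-> nat}) :
    \int[P]_x (g (W x))%:E = \int[distribution P W]_k (g k)%:E.
  by rewrite ge0_integral_pushforward// => k _; rewrite lee_fin.
by rewrite !H; apply: eq_measure_integral => A mA _; exact: ZZ'.
Qed.

Lemma integral_unit_fin_num (f : T -> R) : measurable_fun setT f ->
  (forall x, 0 <= f x <= 1)%R -> \int[P]_x (f x)%:E \is a fin_num.
Proof.
move=> mf f01; apply: integrable_fin_num => //.
apply: measurable_bounded_integrable => //.
  by rewrite (le_lt_trans (probability_le1 _ _))// ltry.
exists 1%R; split => // M M1 x _ /=.
by have /andP[f0 f1] := f01 x; rewrite ger0_norm// (le_trans f1)// ltW.
Qed.

(** Each further offspring variable is independent of the weight built so far and contributes one
    factor, the generating function common to its generation. *)
Lemma integral_partial_offspring n j l (z : R) : (0 <= z <= 1)%R ->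
  \int[P]_x ((X n x == l)%:R * z ^+ partial_offspring n j x)%:E =
  \int[P]_x ((X n x == l)%:R)%:E * (\int[P]_x (z ^+ xi n.+1 1%N x)%:E) ^+ j.
Proof.
move=> /andP[z0 z1]; elim: j => [|j IHj].
  rewrite expe0 mule1; apply: eq_integral => x _.
  by rewrite /partial_offspring big_geq// mulr1.
under eq_integral do rewrite partial_offspringS exprD mulrA EFinM.
rewrite (@integral_indep_weightM _ _ _ P _ Y (future n j) _
  (fun b => z ^+ b)%R (inl (n.+1, j.+1)))//.
- rewrite IHj expeS [X in _ = _ * X]muleC muleA; congr (_ * _).
  apply: (integral_identically_distributed (g := fun b => z ^+ b)%R).
    exact: (inar_identical hX).
  by move=> k; exact: exprn_ge0.
- by move=> b; exact: exprn_ge0.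
- apply: (@indep_weight_partial_offspring n j (fun a v => (a == l)%:R * z ^+ v)%R).
    exact: inar_past_independent.
  by move=> a v; rewrite mulr_ge0// exprn_ge0.
- apply: integral_unit_fin_num.
    apply/measurable_EFinP.
    have [] := @indep_weight_partial_offspring n j (fun a v => (a == l)%:R * z ^+ v)%R
      (inar_past_independent n) => //.
    by move=> a v; rewrite mulr_ge0// exprn_ge0.
  move=> x; rewrite mulr_ge0 ?exprn_ge0//= mulr_ile1 ?exprn_ge0 ?exprn_ile1//.
  by case: eqP.
- by rewrite /= eqxx ltnS leqnn ltnn.
Qed.

(** On [X n = l] the offspring sum has [l] independent terms and contributes [q ^+ l], and the
    immigration factors out. Both sides are expanded over [l] and compared termwise. *)
Lemma pgf_inar_succ n (z : R) : (0 <= z <= 1)%R ->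
  \int[P]_x (z ^+ X n.+1 x)%:E =
  \int[P]_x ((fine (\int[P]_x (z ^+ xi n.+1 1%N x)%:E)) ^+ X n x)%:E *
  \int[P]_x (z ^+ eps n.+1 x)%:E.
Proof.
move=> z01; have /andP[z0 z1] := z01; set q := fine _.
have mpow (W : {RV P >-> nat}) (u : R) : measurable_fun setT (fun x => u ^+ W x)%R.
  exact: (@measurableT_comp _ _ _ _ _ _ (fun k => u ^+ k)%R).
have ipow (W : {RV P >-> nat}) : \int[P]_x (z ^+ W x)%:E \is a fin_num.
  apply: integral_unit_fin_num => // x.
  by rewrite exprn_ge0//= exprn_ile1.
have q0 : (0 <= q)%R.
  by apply: fine_ge0; apply: integral_ge0 => x _; rewrite lee_fin exprn_ge0.
have indX l := @indep_weight_partial_offspring n l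
  (fun a v => (a == l)%:R * z ^+ v)%R (inar_past_independent n).
have g0 l (a v : nat) : (0 <= (a == l)%:R * z ^+ v :> R)%R.
  by rewrite mulr_ge0// exprn_ge0.
under eq_integral do rewrite inar_succ.
rewrite (@ge0_integral_select _ _ _ P (X n) (fun l x =>
  (z ^+ (partial_offspring n l x + eps n.+1 x))%:E))//; last 2 first.
- move=> l; have [] := @indep_weight_inar_step n l (fun _ v => z ^+ v)%R
    (inar_past_independent n) => //.
  by move=> _ v; rewrite exprn_ge0.
- by move=> l x; rewrite lee_fin exprn_ge0.
rewrite (@ge0_integral_select _ _ _ P (X n) (fun l x => (q ^+ l)%:E))//; last first.
  by move=> l x; rewrite lee_fin exprn_ge0.
rewrite -ge0_nneseriesZr//; last first.
  by move=> l; apply: integral_ge0 => x _; rewrite lee_fin exprn_ge0.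
apply: eq_eseriesr => l _; rewrite !integral_mkcondr !patch_EFin_indic.
under eq_integral do rewrite exprD mulrA EFinM.
rewrite (@integral_indep_weightM _ _ _ P _ Y (future n l) _
  (fun b => z ^+ b)%R (inr n.+1))//=; first last.
- apply: integral_unit_fin_num.
    by apply/measurable_EFinP; have [] := indX l (g0 l).
  move=> x; rewrite g0/= mulr_ile1 ?exprn_ge0 ?exprn_ile1//.
  by case: eqP.
- by apply: indX; exact: g0.
- by move=> b; exact: exprn_ge0.
congr (_ * _); rewrite integral_partial_offspring//.
rewrite -[\int[P]_x (z ^+ xi n.+1 1 x)%:E]fineK// -/q -EFin_expe.
rewrite -ge0_integralZr//; last by rewrite lee_fin exprn_ge0.
by apply/measurable_EFinP; exact: (@measurableT_comp _ _ _ _ _ _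
  (fun k => (k == l)%:R : R)%R).
Qed.

End inar_pgf.

(** * Convergence of laws on the natural numbers *)

Local Open Scope ring_scope.

Section probability_on_nat.
Local Set Implicit Arguments.
Local Unset Strict Implicit.
Context {R : realType}.
Implicit Types (Q : probability nat R) (g : nat -> R).

Definition mass Q (k : nat) : R := fine (Q [set k]).

Definition tail (K : nat) : set nat := [set k | (K <= k)%N].

Lemma tail0 : tail 0 = setT.
Proof. by apply/seteqP; split. Qed.

Lemma tailS K : tail K = [set K] `|` tail K.+1.
Proof.
apply/seteqP; split=> [k /= |k [->|]] /=; rewrite /tail /= ?leqnn//.
  by rewrite leq_eqVlt => /orP[/eqP->|]; [left|right].
exact: ltnW.
Qed.

Lemma bounded_integrable_nat Q g M (D : set nat) :
  (forall k, `|g k| <= M) -> Q.-integrable D (EFin \o g).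
Proof.
move=> gM; apply: measurable_bounded_integrable => //.
  by rewrite (le_lt_trans (probability_le1 _ _))// ltry.
by exists M; split => [|N MN k _ /=]; rewrite ?num_real// (le_trans (gM k))// ltW.
Qed.

Lemma Rintegral_tail Q g M K : (forall k, `|g k| <= M) ->
  \int[Q]_k g k = \sum_(k < K) g k * mass Q k + \int[Q]_(k in tail K) g k.
Proof.
move=> gM; elim: K => [|K ->]; first by rewrite big_ord0 add0r tail0.
rewrite big_ord_recr -addrA; congr (_ + _).
rewrite tailS Rintegral_setU//; first last.
- by apply/disj_setPLR => k /= ->; rewrite /tail /= ltnn.
- exact: bounded_integrable_nat gM.
congr (_ + _); rewrite -Rintegral_cst//.
by apply: eq_Rintegral => k; rewrite inE => ->.
Qed.

Lemma mass_tail Q K : fine (Q (tail K)) = 1 - \sum_(k < K) mass Q k.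
Proof.
have := @Rintegral_tail Q (fun=> 1) 1 K; rewrite normr1 => /(_ (fun=> lexx _)).
rewrite !Rintegral_cst//= probability_setT /= !mul1r.
under eq_bigr do rewrite mul1r.
by move=> ->; rewrite addrC addKr.
Qed.

(** The error is the tail integral. [M] serves integrability, while [c] only has to hold from [K]
    on, so it can be as small as [z ^+ K] for a generating function. *)
Lemma Rintegral_approx Q g M c K : (forall k, `|g k| <= M) ->
  (forall k, (K <= k)%N -> `|g k| <= c) ->
  `|\int[Q]_k g k - \sum_(k < K) g k * mass Q k| <=
  c * (1 - \sum_(k < K) mass Q k).
Proof.
move=> gM gc; rewrite (Rintegral_tail Q K gM) addrC addKr -mass_tail.
have gi : Q.-integrable (tail K) (EFin \o g) by exact: bounded_integrable_nat gM.
apply: le_trans (le_normr_Rintegral _ gi) _ => //.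
rewrite -Rintegral_cst//; apply: le_Rintegral => //.
- by apply: (@bounded_integrable_nat _ _ M) => k; rewrite normr_id.
- by apply: (@bounded_integrable_nat _ _ `|c|).
Qed.

Lemma mass_ge0 Q k : 0 <= mass Q k.
Proof. exact: fine_ge0. Qed.

Lemma mass_tail_cvg0 Q : 1 - \sum_(k < K) mass Q k @[K --> \oo] --> (0 : R).
Proof.
under eq_fun do rewrite -mass_tail.
have -> : (0 : R) = fine (Q (\bigcap_K tail K)).
  rewrite (_ : \bigcap_K tail K = set0) ?measure0//.
  apply/seteqP; split=> // k /(_ k.+1 I); by rewrite /tail /= ltnn.
apply: fine_cvg.
rewrite fineK; last by apply: fin_num_measure.
apply: nonincreasing_cvg_mu => //.
  by rewrite (le_lt_trans (probability_le1 _ _))// ltry.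
move=> m n mn; apply/subsetPset => k /=; rewrite /tail /=; exact: leq_trans.
Qed.

Lemma cvg_sum_ord (m : nat) (f : 'I_m -> nat -> R) (l : 'I_m -> R) :
  (forall j, f j n @[n --> \oo] --> l j) ->
  \sum_(j < m) f j n @[n --> \oo] --> \sum_(j < m) l j.
Proof.
move=> fl; apply: (@cvg_big _ _ +%R 0) => [|j _]; last exact: fl.
exact: add_continuous.
Qed.

(** Tightness follows from convergence of the masses: the tail mass of [Qn n] is one minus a finite
    sum, hence converges to that of [Q]. *)
Lemma cvg_Rintegral_mass (Qn : nat -> probability nat R) Q g M :
  (forall k, mass (Qn n) k @[n --> \oo] --> mass Q k) ->
  (forall k, `|g k| <= M) ->
  \int[Qn n]_k g k @[n --> \oo] --> \int[Q]_k g k.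
Proof.
move=> QnQ gM; apply/cvgrPdist_le => e e0.
have M0 : 0 <= M by exact: le_trans (gM 0%N).
(* Of the budget [e], one quarter goes to the tail of [Q], two to the tail of [Qn n] and one to the
   difference of the finite sums. *)
have [K HK] : exists K, M * (1 - \sum_(k < K) mass Q k) <= e / 4.
  have : M * (1 - \sum_(k < K) mass Q k) @[K --> \oo] --> M * 0.
    by apply: cvgMr; exact: mass_tail_cvg0.
  rewrite mulr0 => /cvgrPdist_le /(_ (e / 4)) [|K _ /(_ K (leqnn K))].
    by rewrite divr_gt0.
  by rewrite sub0r normrN => /(le_trans (ler_norm _)); exists K.
have H1 : M * (1 - \sum_(k < K) mass (Qn n) k) @[n --> \oo] -->
    M * (1 - \sum_(k < K) mass Q k).
  apply: cvgMr; apply: cvgB; first exact: cvg_cst.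
  by apply: cvg_sum_ord => k; exact: QnQ.
have H2 : \sum_(k < K) g k * mass (Qn n) k @[n --> \oo] -->
    \sum_(k < K) g k * mass Q k.
  by apply: cvg_sum_ord => k; apply: cvgMr; exact: QnQ.
have e4 : 0 < e / 4 by rewrite divr_gt0.
move/cvgrPdist_le: H1 => /(_ _ e4) H1; move/cvgrPdist_le: H2 => /(_ _ e4) H2.
near=> n.
have A1 := @Rintegral_approx Q g M M K gM (fun k _ => gM k).
have A2 := @Rintegral_approx (Qn n) g M M K gM (fun k _ => gM k).
have B1 : `|M * (1 - \sum_(k < K) mass Q k) -
    M * (1 - \sum_(k < K) mass (Qn n) k)| <= e / 4 by near: n.
have B2 : `|\sum_(k < K) g k * mass Q k -
    \sum_(k < K) g k * mass (Qn n) k| <= e / 4 by near: n.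
move: A1 A2 B1 B2 HK; rewrite !ler_norml; lra.
Unshelve. all: by end_near. Qed.

(** Once the masses below [k] are known to converge, dividing by [z ^+ k] isolates the mass at [k]
    up to an error of order [z]. *)
Lemma cvg_mass_pgf (Qn : nat -> probability nat R) Q :
  (forall z, 0 <= z <= 1 ->
    \int[Qn n]_k (z ^+ k) @[n --> \oo] --> \int[Q]_k (z ^+ k)) ->
  forall k, mass (Qn n) k @[n --> \oo] --> mass Q k.
Proof.
move=> QnQ k; elim/ltn_ind: k => k IHk; apply/cvgrPdist_le => e e0.
(* Four errors of size [z ^+ k.+1] arise, two from truncation and two from convergence; relative to
   [z ^+ k] they total [4 * z], at most [e]. *)
pose z := Num.min 1 (e / 4).
have z0 : 0 < z by rewrite lt_min ltr01 divr_gt0.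
have z1 : z <= 1 by rewrite ge_min lexx.
have ze : z <= e / 4 by rewrite ge_min lexx orbT.
have zk0 : 0 < z ^+ k.+1 by exact: exprn_gt0.
have H1 : \int[Qn n]_k (z ^+ k) @[n --> \oo] --> \int[Q]_k (z ^+ k).
  by apply: QnQ; rewrite ltW.
have H2 : \sum_(j < k) z ^+ j * mass (Qn n) j @[n --> \oo] -->
    \sum_(j < k) z ^+ j * mass Q j.
  by apply: cvg_sum_ord => j; apply: cvgMr; exact: IHk.
move/cvgrPdist_le: H1 => /(_ _ zk0) H1; move/cvgrPdist_le: H2 => /(_ _ zk0) H2.
near=> n.
have B1 : `|\int[Q]_k (z ^+ k) - \int[Qn n]_k (z ^+ k)| <= z ^+ k.+1 by near: n.
have B2 : `|\sum_(j < k) z ^+ j * mass Q j -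
    \sum_(j < k) z ^+ j * mass (Qn n) j| <= z ^+ k.+1 by near: n.
have A (Q' : probability nat R) :
    `|\int[Q']_k (z ^+ k) - (\sum_(j < k) z ^+ j * mass Q' j +
      z ^+ k * mass Q' k)| <= z ^+ k.+1.
  have := @Rintegral_approx Q' (fun j => z ^+ j) 1 (z ^+ k.+1) k.+1.
  rewrite big_ord_recr /= => H; apply: le_trans (H _ _) _.
  - by move=> j; rewrite ger0_norm ?exprn_ge0 ?exprn_ile1// ltW.
  - move=> j kj; rewrite ger0_norm ?exprn_ge0 ?(ltW z0)//.
    exact: ler_wiXn2l (ltW z0) z1 _ _ kj.
  - rewrite ler_piMr ?(ltW zk0)// gerBl; apply: sumr_ge0 => j _.
    exact: mass_ge0.
have A1 := A Q; have A2 := A (Qn n).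
have : `|z ^+ k * (mass Q k - mass (Qn n) k)| <= z ^+ k * (4 * z).
  have -> : z ^+ k * (4 * z) = 4 * z ^+ k.+1 by rewrite exprSr; ring.
  move: A1 A2 B1 B2; rewrite mulrBr !ler_norml; lra.
rewrite normrM (ger0_norm (ltW (exprn_gt0 k z0))) ler_pM2l ?exprn_gt0// => H.
by apply: le_trans H _; lra.
Unshelve. all: by end_near. Qed.

End probability_on_nat.

(** * Elementary bounds for powers and the exponential *)

Section elementary_bounds.
Local Set Implicit Arguments.
Local Unset Strict Implicit.
Context {R : realType}.

(** Induction on [k], multiplying by [1 - u]. The coefficient [k * (k - 1)], twice the binomial one,
    is chosen to integrate to the second factorial moment. *)
Lemma exprB1_bounds (u : R) (k : nat) : 0 <= u <= 1 ->
  1 - k%:R * u <= (1 - u) ^+ k <= 1 - k%:R * u + (k * (k - 1))%:R * u ^+ 2.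
Proof.
move=> /andP[u0 u1]; elim: k => [|k /andP[IH1 IH2]].
  by rewrite expr0 !mul0r subr0 addr0 lexx.
have kkE : (k.+1 * (k.+1 - 1))%:R = (k * (k - 1))%:R + 2 * k%:R :> R.
  rewrite -natrM -natrD; congr (_%:R).
  by case: k {IH1 IH2} => // k; rewrite !subn1 /=; lia.
have c0 : 0 <= (k * (k - 1))%:R :> R by [].
have k0 : 0 <= k%:R :> R by [].
have w0 : 0 <= 1 - u by lra.
rewrite kkE exprS -[k.+1]addn1 natrD; move: IH1 IH2 c0 k0.
move: (k * (k - 1))%:R k%:R ((1 - u) ^+ k) => c k' p IH1 IH2 c0 k0.
apply/andP; split.
  apply: le_trans (ler_wpM2l w0 IH1); nra.
apply: le_trans (ler_wpM2l w0 IH2) _.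
have : 0 <= k' * u ^+ 2 by rewrite mulr_ge0// sqr_ge0.
have : 0 <= c * u ^+ 3 by rewrite mulr_ge0// exprn_ge0.
nra.
Qed.

(** The upper bound passes through [(1 + x)^-1], since [(1 - x + x ^+ 2) * (1 + x) = 1 + x ^+ 3]. *)
Lemma expRN_bounds (x : R) : 0 <= x -> 1 - x <= expR (- x) <= 1 - x + x ^+ 2.
Proof.
move=> x0; rewrite expR_ge1Dx /= expRN.
have e1 : 1 + x <= expR x by exact: expR_ge1Dx.
have x1 : 0 < 1 + x by lra.
apply: (@le_trans _ _ (1 + x)^-1).
  by rewrite lef_pV2// posrE// expR_gt0.
rewrite -[X in X <= _]mul1r ler_pdivrMr//.
have : 0 <= x ^+ 3 by rewrite exprn_ge0.
nra.
Qed.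

End elementary_bounds.

(** * Generating functions near 1, and that of the Poisson law *)

Section pgf.
Local Set Implicit Arguments.
Local Unset Strict Implicit.
Context {R : realType}.
Implicit Types Q : probability nat R.

Lemma pgf_ge0_le1 Q (z : R) : 0 <= z <= 1 -> 0 <= \int[Q]_k (z ^+ k) <= 1.
Proof.
move=> /andP[z0 z1]; rewrite Rintegral_ge0/=; last by move=> k _; exact: exprn_ge0.
have <- : \int[Q]_(k in setT) (1 : R) = 1.
  by rewrite Rintegral_cst//= probability_setT mul1r.
apply: le_Rintegral => //.
- apply: (@bounded_integrable_nat _ _ _ 1) => k.
  by rewrite ger0_norm ?exprn_ge0 ?exprn_ile1.
- by apply: (@bounded_integrable_nat _ _ _ 1) => k; rewrite normr1.
- by move=> k _; exact: exprn_ile1.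
Qed.

(** Truncation at [K] loses at most [e / 2] of the mass, and Bernoulli's inequality costs at most
    [K%:R * u] on the rest. Laws with infinite mean are covered. *)
Lemma pgf_near1 Q (e : R) : 0 < e -> exists2 eta, 0 < eta &
  forall u, 0 <= u <= 1 -> u <= eta -> 1 - e <= \int[Q]_k ((1 - u) ^+ k).
Proof.
move=> e0; have e2 : 0 < e / 2 by rewrite divr_gt0.
have [K HK] : exists K, 1 - \sum_(k < K) mass Q k <= e / 2.
  have /cvgrPdist_le /(_ _ e2) [K _ /(_ K (leqnn K))] := mass_tail_cvg0 Q.
  by rewrite sub0r normrN => /(le_trans (ler_norm _)); exists K.
have K1 : 0 < K%:R + 1 :> R by rewrite ltr_wpDl.
exists (e / 2 / (K%:R + 1)); first by rewrite divr_gt0.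
move=> u /andP[u0 u1]; rewrite ler_pdivlMr// => uK.
have w0 : 0 <= 1 - u <= 1 by apply/andP; split; lra.
have /andP[w00 w01] := w0.
rewrite (@Rintegral_tail _ _ _ 1 K); last first.
  by move=> k; rewrite ger0_norm ?exprn_ge0 ?exprn_ile1.
apply: ler_wpDr; first by apply: Rintegral_ge0 => k _; rewrite exprn_ge0.
apply: (@le_trans _ _ (\sum_(k < K) (mass Q k - K%:R * u * mass Q k))).
  rewrite sumrB -mulr_sumr.
  have S1 : \sum_(k < K) mass Q k <= 1.
    by rewrite -subr_ge0 -mass_tail fine_ge0.
  have : K%:R * u * (\sum_(k < K) mass Q k) <= K%:R * u.
    by rewrite ler_piMr// mulr_ge0.
  have : K%:R * u <= e / 2 by lra.
  lra.
apply: ler_sum => k _.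
rewrite -[X in X - _]mul1r -mulrBl ler_wpM2r ?mass_ge0//.
have u01 : 0 <= u <= 1 by rewrite u0.
have /andP[+ _] := exprB1_bounds k u01; apply: le_trans.
by rewrite lerB// ler_wpM2r// ler_nat ltnW.
Qed.

(** At rate 0 the law is the Dirac mass at 0, which the formula still gives because [0 ^+ 0 = 1]. *)
Lemma mass_poisson (lambda : R) k : 0 <= lambda ->
  mass (poisson_prob lambda 0%N) k = lambda ^+ k / k`!%:R * expR (- lambda).
Proof.
move=> l0; rewrite /mass [X in fine X](_ : _ = if 0 < lambda then
  (\esum_(j in [set k]) (poisson_pmf lambda j)%:E)%E else \d_0%N [set k])//.
move: l0; rewrite le_eqVlt => /predU1P[<-|l0].
  rewrite ltxx /dirac indicE oppr0 expR0 mulr1 expr0n.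
  case: k => [|k]; first by rewrite mem_set//= fact0 divr1.
  by rewrite memNset//= mul0r.
by rewrite l0 esum_set1 ?lee_fin ?poisson_pmf_ge0//= /poisson_pmf l0.
Qed.

(** Exponential tilting: [(1 - s) ^+ k] turns the masses at rate [lambda] into
    [expR (- (lambda * s))] times those at rate [lambda * (1 - s)], whose partial sums tend to 1. *)
Lemma pgf_poisson (lambda s : R) : 0 <= lambda -> 0 <= s <= 1 ->
  \int[poisson_prob lambda 0%N]_k ((1 - s) ^+ k) = expR (- (lambda * s)).
Proof.
move=> l0 /andP[s0 s1]; set Q := poisson_prob _ _.
have z0 : 0 <= 1 - s by lra.
have z1 : 1 - s <= 1 by lra.
have lz0 : 0 <= lambda * (1 - s) by rewrite mulr_ge0.
have partialE K : \sum_(k < K) (1 - s) ^+ k * mass Q k =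
    expR (- (lambda * s)) *
    \sum_(k < K) mass (poisson_prob (lambda * (1 - s)) 0%N) k.
  rewrite mulr_sumr; apply: eq_bigr => k _.
  rewrite !mass_poisson// exprMn.
  have -> : expR (- lambda) = expR (- (lambda * s)) * expR (- (lambda * (1 - s))).
    by rewrite -expRD; congr expR; ring.
  ring.
have H1 : \sum_(k < K) (1 - s) ^+ k * mass Q k @[K --> \oo] -->
    expR (- (lambda * s)) * 1.
  under eq_fun do rewrite partialE.
  apply: cvgMr.
  pose Q' : probability nat R := poisson_prob (lambda * (1 - s)) 0%N.
  have : 1 - (1 - \sum_(k < K) mass Q' k) @[K --> \oo] --> (1 - 0 : R).
    by apply: cvgB; [exact: cvg_cst|exact: mass_tail_cvg0].
  by rewrite subr0; under eq_fun do rewrite subKr.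
have H2 : \sum_(k < K) (1 - s) ^+ k * mass Q k @[K --> \oo] -->
    \int[Q]_k ((1 - s) ^+ k).
  apply/cvgrPdist_le => e e0.
  have /cvgrPdist_le /(_ _ e0) := mass_tail_cvg0 Q.
  apply: filterS => K; rewrite sub0r normrN => /(le_trans (ler_norm _)).
  apply: le_trans; rewrite -[X in _ <= X]mul1r.
  apply: (@Rintegral_approx _ Q (fun k => (1 - s) ^+ k) 1) => k.
    by rewrite ger0_norm ?exprn_ge0 ?exprn_ile1.
  by rewrite ger0_norm ?exprn_ge0 ?exprn_ile1.
by rewrite -(cvg_lim _ H2)// (cvg_lim _ H1)// mulr1.
Qed.

End pgf.

(** * The perturbed thinning recursion *)

Section thinning_recursion.
Local Set Implicit Arguments.
Local Unset Strict Implicit.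
Context {R : realType}.

(** Each factor satisfies [rho k <= expR (- (1 - rho k))], so the product is at most the exponential
    of minus a divergent sum. *)
Lemma prod_cvg0 (rho : nat -> R) (N : nat) : (forall n, 0 <= rho n <= 1) ->
  \sum_(0 <= k < n) (1 - rho k) @[n --> \oo] --> +oo ->
  \prod_(N <= k < n) rho k @[n --> \oo] --> (0 : R).
Proof.
move=> rho01 /cvgryPge sum_rho.
have prod_le n : 0 <= \prod_(N <= k < n) rho k <=
    expR (- \sum_(N <= k < n) (1 - rho k)).
  rewrite -sumrN expR_sum; apply/andP; split.
    by apply: prodr_ge0 => k _; have /andP[] := rho01 k.
  apply: ler_prod => k _; have /andP[-> _] := rho01 k.
  by have := expR_ge1Dx (- (1 - rho k)); rewrite opprB addrC subrK.
apply/cvgrPdist_le => e e0.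
near=> n.
have /andP[p0 pe] := prod_le n.
rewrite sub0r normrN ger0_norm//; apply: le_trans pe _.
rewrite -[X in _ <= X]lnK ?posrE// ler_expR lerNl.
have : \sum_(0 <= k < N) (1 - rho k) - ln e <= \sum_(0 <= k < n) (1 - rho k).
  by near: n; exact: sum_rho.
have Nn : (N <= n)%N by near: n; exact: nbhs_infty_ge.
by rewrite [X in _ <= X](@big_cat_nat _ _ _ N)//= lerD2l.
Unshelve. all: by end_near. Qed.

(** Here [rho n] leads from time [n] to [n.+1]. The starting time [N] is fixed before [n] grows, so
    continuity of [H N] at 0 is enough, without uniformity in time. *)
Lemma thinning_recursion_cvg (H K : nat -> R -> R) (lambda : R)
    (rho delta : nat -> R) : 0 <= lambda ->
  (forall n, 0 <= rho n <= 1) ->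
  \sum_(0 <= k < n) (1 - rho k) @[n --> \oo] --> +oo ->
  (forall n s, 0 <= s <= 1 -> H n.+1 s = H n (rho n * s) * K n s) ->
  (forall n s, 0 <= s <= 1 -> 0 <= K n s <= 1) ->
  (\forall n \near \oo, forall s, 0 <= s <= 1 ->
    `|K n s - expR (- (lambda * ((1 - rho n) * s)))| <=
      s * (1 - rho n) * delta n) ->
  delta n @[n --> \oo] --> (0 : R) ->
  (forall n e, 0 < e -> exists2 eta, 0 < eta & forall u, 0 <= u <= 1 ->
    u <= eta -> `|H n u - 1| <= e) ->
  forall s, 0 <= s <= 1 -> H n s @[n --> \oo] --> expR (- (lambda * s)).
Proof.
move=> l0 rho01 sum_rho HS K01 KE delta0 H1 s s01.
apply/cvgrPdist_le => e e0; have e3 : 0 < e / 3 by rewrite divr_gt0.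
move/cvgrPdist_le: delta0 => /(_ _ e3) delta0.
have [N _ HN] := filterI KE delta0.
pose E u := expR (- (lambda * u)).
have E01 u : 0 <= u -> 0 <= E u <= 1.
  by move=> u0; rewrite expR_ge0 -expR0 ler_expR oppr_le0 mulr_ge0.
(* A perturbation of size (1 - rho) * e / 3 per step adds up to at most e / 3,
   because the previous ones are thinned by rho. *)
have bound m u : 0 <= u <= 1 ->
    `|H (N + m)%N u - E u| <=
    `|H N (\prod_(N <= k < N + m) rho k * u) -
      E (\prod_(N <= k < N + m) rho k * u)| + e / 3 * u.
  elim: m u => [|m IHm] u /andP[u0 u1].
    by rewrite addn0 big_geq// mul1r lerDl mulr_ge0// ltW.
  have u01 : 0 <= u <= 1 by rewrite u0.
  set n := (N + m)%N in IHm *.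
  have /andP[r0 r1] := rho01 n.
  have ru01 : 0 <= rho n * u <= 1 by rewrite mulr_ge0//= mulr_ile1.
  rewrite addnS -/n HS// big_nat_recr ?leq_addr//= -mulrA.
  have {IHm} := IHm _ ru01.
  move: (`|H N (_ * (rho n * u)) - _|) => A IHm.
  (* The limit [E] solves the unperturbed recursion exactly. *)
  have EE : E u = E (rho n * u) * E ((1 - rho n) * u).
    by rewrite /E -expRD; congr expR; ring.
  have -> : H n (rho n * u) * K n u - E u =
      (H n (rho n * u) - E (rho n * u)) * K n u +
      E (rho n * u) * (K n u - E ((1 - rho n) * u)) by rewrite EE; ring.
  apply: le_trans (ler_normD _ _) _; rewrite !normrM.
  have /andP[K0 K1] := K01 n _ u01.
  have /andP[E0 E1] : 0 <= E (rho n * u) <= 1 by apply: E01; case/andP: ru01.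
  rewrite (ger0_norm K0) (ger0_norm E0).
  have [HK] := HN n (leq_addr m N); rewrite /= sub0r normrN => Hd.
  have B1 : `|H n (rho n * u) - E (rho n * u)| * K n u <= A + e / 3 * (rho n * u).
    by apply: le_trans IHm; rewrite ler_piMr.
  have B2 : E (rho n * u) * `|K n u - E ((1 - rho n) * u)| <=
      u * (1 - rho n) * (e / 3).
    apply: (@le_trans _ _ `|K n u - E ((1 - rho n) * u)|); first by rewrite ler_piMl.
    apply: le_trans (HK _ u01) _; rewrite ler_wpM2l//.
      by rewrite mulr_ge0// subr_ge0.
    exact: le_trans (ler_norm _) Hd.
  apply: le_trans (lerD B1 B2) _; rewrite -addrA lerD2l.
  lra.
have [eta eta0 Heta] := H1 N _ e3.
have l1 : 0 < lambda + 1 by lra.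
(* The first bound puts [H N] at the thinned argument within [e / 3] of 1, the second does so for
   [E]; [lambda + 1] is positive even when [lambda] is 0. *)
have eta'0 : 0 < Num.min eta (e / 3 / (lambda + 1)).
  by rewrite lt_min eta0 divr_gt0.
have /cvgrPdist_le /(_ _ eta'0) prod0 := prod_cvg0 N rho01 sum_rho.
near=> n.
have Nn : (N <= n)%N by near: n; exact: nbhs_infty_ge.
have : `|0 - \prod_(N <= k < n) rho k| <= Num.min eta (e / 3 / (lambda + 1)).
  by near: n.
have p0 : 0 <= \prod_(N <= k < n) rho k.
  by apply: prodr_ge0 => k _; have /andP[] := rho01 k.
rewrite sub0r normrN ger0_norm// le_min ler_pdivlMr// => /andP[p1 p2].
have /andP[s0 s1] := s01.
have := bound (n - N)%N s s01; rewrite subnKC// distrC.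
move: p0 p1 p2; set p := \prod_(_ <= k < _) _ k => p0 p1 p2.
have pp : p <= 1.
  by rewrite /p; apply: prodr_ile1 => k _; exact: rho01.
have ps0 : 0 <= p * s by rewrite mulr_ge0.
have psp : p * s <= p by rewrite ler_piMr.
have ps01 : 0 <= p * s <= 1 by rewrite ps0 (le_trans psp).
have B1 := Heta _ ps01 (le_trans psp p1).
have [B2 _] := andP (expRN_bounds (mulr_ge0 l0 ps0)).
have /andP[_ B3] := E01 _ ps0.
have B4 : lambda * (p * s) <= e / 3.
  have : lambda * (p * s) <= lambda * p by rewrite ler_wpM2l.
  lra.
have B5 : e / 3 * s <= e / 3 by rewrite ler_piMr// ltW.
move: B1 B2 B3; rewrite -/(E (p * s)) => B1 B2 B3.
have : `|H N (p * s) - E (p * s)| <= e / 3 + e / 3.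
  move: B1; rewrite !ler_norml => /andP[B1 B1'].
  by apply/andP; split; lra.
rewrite -/(E s) => C1 C2; apply: le_trans C2 _; lra.
Unshelve. all: by end_near. Qed.

End thinning_recursion.

(** * Moment estimates for immigration and Bernoulli offspring *)

Section two_moments.
Local Set Implicit Arguments.
Local Unset Strict Implicit.
Context {R : realType}.
Implicit Types Q : probability nat R.

Lemma pgf_two_moments Q (m1 m2 s : R) :
  (\int[Q]_k (k%:R)%:E = m1%:E)%E ->
  (\int[Q]_k ((k * (k - 1))%:R)%:E = m2%:E)%E -> 0 <= s <= 1 ->
  1 - m1 * s <= \int[Q]_k ((1 - s) ^+ k) <= 1 - m1 * s + m2 * s ^+ 2.
Proof.
move=> Hm1 Hm2 s01; have /andP[s0 s1] := s01.
have int_nat (g : nat -> R) c : (forall k, 0 <= g k) ->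
    (\int[Q]_k (g k)%:E = c%:E)%E -> Q.-integrable setT (EFin \o g).
  move=> g0 gc; apply/integrableP; split=> //.
  under eq_integral do rewrite /= ger0_norm//.
  by rewrite gc ltry.
have i1 := int_nat (fun k => k%:R) _ (fun k => ler0n _ _) Hm1.
have i2 := int_nat (fun k => (k * (k - 1))%:R) _ (fun k => ler0n _ _) Hm2.
have ip : Q.-integrable setT (EFin \o fun k => (1 - s) ^+ k).
  apply: (@bounded_integrable_nat _ _ _ 1) => k.
  by rewrite ger0_norm ?exprn_ge0 ?exprn_ile1//; lra.
have ic : Q.-integrable setT (EFin \o fun=> 1).
  by apply: (@bounded_integrable_nat _ _ _ 1) => k; rewrite normr1.
have i1s : Q.-integrable setT (EFin \o fun k => k%:R * s).
  exact: (integrableZr measurableT s i1).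
have i2s : Q.-integrable setT (EFin \o fun k => (k * (k - 1))%:R * s ^+ 2).
  exact: (integrableZr measurableT (s ^+ 2) i2).
have i1' : Q.-integrable setT (EFin \o fun k => 1 - k%:R * s).
  exact: (integrableB measurableT ic i1s).
have i2' : Q.-integrable setT
    (EFin \o fun k => 1 - k%:R * s + (k * (k - 1))%:R * s ^+ 2).
  exact: (integrableD measurableT i1' i2s).
have E1 : \int[Q]_k (1 - k%:R * s) = 1 - m1 * s.
  rewrite RintegralB// Rintegral_cst//= probability_setT mul1r RintegralZr//.
  by rewrite /Rintegral Hm1.
rewrite -E1; have -> : m2 = \int[Q]_k (k * (k - 1))%:R by rewrite /Rintegral Hm2.
rewrite -RintegralZr// -RintegralD//.
by apply/andP; split; apply: le_Rintegral => // k _;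
  have /andP[] := exprB1_bounds k s01.
Qed.

(** The linear terms of the two functions differ by [s * (m1 - lambda * r)]; the quadratic
    remainders are bounded by multiples of [s] because [s ^+ 2 <= s]. Factoring out [s * r] gives
    the stated form. *)
Lemma pgf_small_immigration Q (m1 m2 lambda r s : R) :
  (\int[Q]_k (k%:R)%:E = m1%:E)%E ->
  (\int[Q]_k ((k * (k - 1))%:R)%:E = m2%:E)%E -> 0 <= s <= 1 ->
  0 <= lambda -> 0 < r ->
  `|\int[Q]_k ((1 - s) ^+ k) - expR (- (lambda * (r * s)))| <=
  s * r * (`|m1 / r - lambda| + m2 / r + lambda ^+ 2 * r).
Proof.
move=> Hm1 Hm2 s01 l0 r0; have /andP[s0 s1] := s01.
have m20 : 0 <= m2.
  by rewrite -lee_fin -Hm2; apply: integral_ge0 => k _; rewrite lee_fin.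
have /andP[A1 A2] := pgf_two_moments Hm1 Hm2 s01.
have lrs0 : 0 <= lambda * (r * s) by rewrite !mulr_ge0// ltW.
have /andP[B1 B2] := expRN_bounds lrs0.
have s2 : s ^+ 2 <= s by rewrite expr2 ler_piMr.
have C1 : m2 * s ^+ 2 <= m2 * s by rewrite ler_wpM2l.
have C2 : (lambda * (r * s)) ^+ 2 <= (lambda * r) ^+ 2 * s.
  by rewrite mulrA exprMn ler_wpM2l// sqr_ge0.
have rn : r != 0 by rewrite gt_eqF.
have D : s * r * (`|m1 / r - lambda| + m2 / r + lambda ^+ 2 * r) =
    s * (r * `|m1 / r - lambda|) + m2 * s + (lambda * r) ^+ 2 * s by field.
have D1 : s * (r * `|m1 / r - lambda|) = `|s * (m1 - lambda * r)|.
  rewrite -{1}(ger0_norm (ltW r0)) -normrM -{1}(ger0_norm s0) -normrM.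
  by congr (`| _ |); field.
have D2 := ler_norm (s * (m1 - lambda * r)).
have D3 := ler_norm (- (s * (m1 - lambda * r))); rewrite normrN in D3.
have F1 : 0 <= m2 * s by rewrite mulr_ge0.
have F2 : 0 <= (lambda * r) ^+ 2 * s by rewrite mulr_ge0// sqr_ge0.
by rewrite D D1 ler_norml; apply/andP; split; lra.
Qed.

Lemma bernoulli_mean Q : Q [set 0%N; 1%N] = 1%E ->
  (\int[Q]_k (k%:R)%:E)%E = (mass Q 1)%:E /\ mass Q 0 = 1 - mass Q 1.
Proof.
move=> Q01.
have m01 : 1 - \sum_(k < 2) mass Q k = 0.
  rewrite -mass_tail (_ : tail 2 = ~` [set 0%N; 1%N]).
    by rewrite probability_setC// Q01 subee.
  apply/seteqP; split=> [k /= + [] kE|[|[|k]] //= k01].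
  - by rewrite kE.
  - by rewrite kE.
  - by case: k01; left.
  - by case: k01; right.
split; last by move: m01; rewrite !big_ord_recr big_ord0 /=; lra.
(* The unbounded integrand is replaced almost everywhere by the bounded indicator of [k != 0], for
   which truncation at 2 has zero error. *)
have -> : (\int[Q]_k (k%:R)%:E = \int[Q]_k ((k != 0%N)%:R)%:E :> \bar R)%E.
  apply: ae_eq_integral => //.
  exists (tail 2); split=> //.
    rewrite -[LHS]fineK ?mass_tail ?m01//; exact: fin_num_measure.
  by case=> [|[|k]] //= H; exfalso; apply: H.
have g1 (k : nat) : `|(k != 0%N)%:R : R| <= 1.
  by case: eqP => _; rewrite ?normr0 ?normr1.
have := @Rintegral_approx _ Q (fun k => (k != 0%N)%:R) 1 1 2 g1 (fun k _ => g1 k).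
rewrite m01 mulr0 normr_le0 subr_eq0 !big_ord_recr big_ord0 /= => /eqP.
rewrite add0r mul0r add0r mul1r => <-; rewrite /Rintegral fineK//.
by apply: integrable_fin_num => //; exact: bounded_integrable_nat g1.
Qed.

Lemma pgf_bernoulli Q (z : R) : Q [set 0%N; 1%N] = 1%E -> 0 <= z <= 1 ->
  \int[Q]_k (z ^+ k) = 1 - mass Q 1 + mass Q 1 * z.
Proof.
move=> Q01 /andP[z0 z1]; have [_ m0] := bernoulli_mean Q01.
have g1 (k : nat) : `|z ^+ k| <= 1 by rewrite ger0_norm ?exprn_ge0 ?exprn_ile1.
have := @Rintegral_approx _ Q _ 1 1 2 g1 (fun k _ => g1 k).
rewrite !big_ord_recr !big_ord0 /= m0 !add0r subrK subrr mulr0 normr_le0 subr_eq0.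
by move=> /eqP ->; ring.
Qed.

End two_moments.

(** * Passage from random variables to their laws *)

Section law_of_nat_variable.
Local Set Implicit Arguments.
Local Unset Strict Implicit.
Context {R : realType} {d : measure_display} {T : measurableType d}.
Context {P : probability T R}.

Definition law (W : {RV P >-> nat}) : probability nat R := distribution P W.

Lemma ge0_integral_law (W : {RV P >-> nat}) (g : nat -> R) :
  (forall k, 0 <= g k) ->
  (\int[P]_x (g (W x))%:E = \int[law W]_k (g k)%:E)%E.
Proof. by move=> g0; rewrite ge0_integral_pushforward// => k _; rewrite lee_fin. Qed.

Lemma pgf_law (W : {RV P >-> nat}) (z : R) : 0 <= z <= 1 ->
  (\int[P]_x (z ^+ W x)%:E)%E = (\int[law W]_k (z ^+ k))%:E.
Proof.
move=> /andP[z0 z1].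
rewrite (@ge0_integral_law W (fun k => z ^+ k)); last first.
  by move=> k; exact: exprn_ge0.
rewrite /Rintegral fineK//; apply: integrable_fin_num => //.
apply: (@bounded_integrable_nat _ _ _ 1) => k.
by rewrite ger0_norm ?exprn_ge0 ?exprn_ile1.
Qed.

Lemma bounded_integral_distribution (d' : measure_display)
    (T' : measurableType d') (V : {RV P >-> T'}) (f : T' -> R) (M : R) :
  measurable_fun setT f -> (forall y, `|f y| <= M) ->
  (\int[distribution P V]_y (f y)%:E)%E = (\int[P]_x f (V x))%:E.
Proof.
move=> mf fM.
have ifV : P.-integrable setT (EFin \o (f \o V)).
  apply: measurable_bounded_integrable => //.
  - by rewrite (le_lt_trans (probability_le1 _ _))// ltry.
  - exact: measurableT_comp.
  - exists M; split=> [|N MN x _ /=]; first exact: num_real.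
    by rewrite (le_trans (fM _))// ltW.
rewrite integral_distribution//; last exact/measurable_EFinP.
by rewrite /Rintegral fineK//; exact: integrable_fin_num.
Qed.

End law_of_nat_variable.

(** The Bernoulli generating function at [1 - s] is one minus the success probability times [s], so
    in the variable [s] thinning is a mere rescaling. *)
Lemma inar_generating_function (R : realType) (d : measure_display)
    (T : measurableType d) (P : probability T R)
    (xi : nat -> nat -> {RV P >-> nat}) (eps : nat -> {RV P >-> nat})
    (X : nat -> {RV P >-> nat}) (n : nat) (s : R) :
  inhomogeneous_INAR1 P xi eps X -> 0 <= s <= 1 ->
  \int[law (X n.+1)]_k ((1 - s) ^+ k) =
  \int[law (X n)]_k ((1 - mass (law (xi n.+1 1%N)) 1 * s) ^+ k) *
  \int[law (eps n.+1)]_k ((1 - s) ^+ k).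
Proof.
move=> hX /andP[s0 s1].
have z01 : 0 <= 1 - s <= 1 by apply/andP; split; lra.
have ber : law (xi n.+1 1%N) [set 0%N; 1%N] = 1%E by exact: (inar_bernoulli hX).
have [_ m0] := bernoulli_mean ber.
have m1_ge0 := mass_ge0 (law (xi n.+1 1%N)) 1.
have m1_le1 : mass (law (xi n.+1 1%N)) 1 <= 1.
  by rewrite -subr_ge0 -m0 mass_ge0.
have q01 : 0 <= 1 - mass (law (xi n.+1 1%N)) 1 * s <= 1 by apply/andP; split; nra.
have qE : (\int[P]_x ((1 - s) ^+ xi n.+1 1%N x)%:E)%E =
    (1 - mass (law (xi n.+1 1%N)) 1 * s)%:E.
  by rewrite pgf_law// pgf_bernoulli//; congr (_%:E); ring.
by have := pgf_inar_succ hX n z01; rewrite qE !pgf_law// => -[].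
Qed.

(** * Poisson convergence of the process *)

Local Open Scope ereal_scope.

Theorem theorem2 (R : realType) (d : measure_display) (T : measurableType d)
    (P : probability T R)
    (xi : nat -> nat -> {RV P >-> nat}) (eps : nat -> {RV P >-> nat})
    (X : nat -> {RV P >-> nat}) (lambda : R)
    (hX : inhomogeneous_INAR1 P xi eps X)
    (rho_lt1 : forall n : nat, (0 < n)%N -> offspring_mean P xi n < 1)
    (rho_cvg : offspring_mean P xi n @[n --> \oo] --> 1)
    (rho_sum : \sum_(1 <= n <oo) (1 - offspring_mean P xi n) = +oo)
    (lambda_ge0 : (0 <= lambda)%R)
    (m1_cvg : 'E_P[natR R \o eps n] / (1 - offspring_mean P xi n)
                @[n --> \oo] --> lambda%:E)
    (m2_cvg : 'E_P[fun t : T => natR R (eps n t * (eps n t - 1))%N]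
                / (1 - offspring_mean P xi n) @[n --> \oo] --> 0) :
  cvg_in_distribution P (fun n : nat => natR R \o X n) (poissonR lambda).
Proof.
(* This is the mean of generation [n.+1]: index 0 is unconstrained in the process, so all sequences
   are shifted by one. *)
pose rho n : R := mass (law (xi n.+1 1%N)) 1.
have rhoE n : offspring_mean P xi n.+1 = (rho n)%:E.
  have [<- _] := @bernoulli_mean _ (law (xi n.+1 1%N)) (inar_bernoulli hX (ltn0Sn n)).
  rewrite /offspring_mean unlock.
  exact: (@ge0_integral_law _ _ _ _ _ (fun k => k%:R)%R).
have rho1 n : (0 < 1 - rho n)%R.
  by have := rho_lt1 n.+1 isT; rewrite rhoE lte_fin subr_gt0.
have rho01 n : (0 <= rho n <= 1)%R.
  by rewrite mass_ge0/= -subr_ge0 ltW.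
have sum_rho : (\sum_(0 <= k < n) (1 - rho k))%R @[n --> \oo] --> +oo%R.
  apply/cvgeryP.
  (* The terms from index 1 on are nonnegative, so the partial sums have a limit, which [rho_sum]
     identifies as infinite. *)
  have : cvgn (fun n => \sum_(1 <= k < n) (1 - offspring_mean P xi k)).
    apply: is_cvg_nneseries => -[//|k] _ _.
    by rewrite rhoE -EFinB lee_fin ltW.
  move/cvg_toP => /(_ _ rho_sum); rewrite -(cvg_shiftS _).
  apply: cvg_trans; apply: near_eq_cvg; near=> n => /=.
  rewrite big_add1/= -sumEFin; apply: eq_bigr => k _.
  by rewrite rhoE EFinB.
(* [fine] sends an infinite moment to 0, so [m1] and [m2] are guaranteed to be the true moments only
   for large [n], by [moment_cvg]. *)
pose m1 n := fine 'E_P[natR R \o eps n.+1].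
pose m2 n := fine 'E_P[fun t : T => natR R (eps n.+1 t * (eps n.+1 t - 1))%N].
pose delta n : R := (`|m1 n / (1 - rho n) - lambda| + m2 n / (1 - rho n) +
  lambda ^+ 2 * (1 - rho n))%R.
(* A finite limit makes the quotients eventually finite, hence also the moments, since the
   denominators are positive reals. *)
have moment_cvg (m : nat -> \bar R) (l : R) :
    m n / (1 - offspring_mean P xi n) @[n --> \oo] --> l%:E ->
    (\forall n \near \oo, m n.+1 = (fine (m n.+1))%:E) /\
    (fine (m n.+1) / (1 - rho n))%R @[n --> \oo] --> l.
  rewrite -(cvg_shiftS _) => ml.
  have [fin_m ml'] := (fine_cvgP _ _).1 ml.
  have fin n : (m n.+1 / (1 - offspring_mean P xi n.+1)) \is a fin_num ->
      m n.+1 \is a fin_num.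
    rewrite rhoE -EFinB inver gt_eqF//.
    case: (m n.+1) => //=; rewrite ?gt0_mulye ?gt0_mulNye// lte_fin invr_gt0//.
  split; first by apply: filterS fin_m => n /fin /fineK.
  apply: cvg_trans ml'; apply: near_eq_cvg; apply: filterS fin_m => n /fin fn /=.
  by rewrite rhoE -EFinB inver gt_eqF// fineM.
have [fin_m1 m1_lim] := moment_cvg _ _ m1_cvg.
have [fin_m2 m2_lim] := moment_cvg _ _ m2_cvg.
have rho_lim : (1 - rho n)%R @[n --> \oo] --> (0 : R)%R.
  have : fine (offspring_mean P xi n.+1) @[n --> \oo] --> (1 : R)%R.
    by apply: fine_cvg; rewrite cvg_shiftS.
  under eq_fun do rewrite rhoE.
  move=> rl; rewrite -(subrr (1 : R)%R).
  by apply: cvgB => //; exact: cvg_cst.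
have delta_lim : delta n @[n --> \oo] --> (0 : R)%R.
  rewrite (_ : 0 = `|lambda - lambda| + 0 + lambda ^+ 2 * 0 :> R)%R; last first.
    by rewrite subrr normr0 mulr0 !addr0.
  apply: cvgD; last by apply: cvgMr.
  apply: cvgD => //; apply: cvg_norm; apply: cvgB => //; exact: cvg_cst.
pose H n s : R := (\int[law (X n)]_k ((1 - s) ^+ k))%R.
have H_cvg s : (0 <= s <= 1)%R ->
    H n s @[n --> \oo] --> expR (- (lambda * s)).
  apply: (@thinning_recursion_cvg _ H
    (fun n s => \int[law (eps n.+1)]_k ((1 - s) ^+ k))%R lambda rho delta) => //.
  - by move=> n u u01; rewrite /H (inar_generating_function _ _ _ _ _ _ _ _ _ hX).
  - by move=> n u /andP[u0 u1]; apply: pgf_ge0_le1; apply/andP; split; lra.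
  - near=> n => u u01.
    apply: (@pgf_small_immigration _ (law (eps n.+1)) (m1 n) (m2 n)) => //.
      rewrite -(near fin_m1 n)//; rewrite unlock.
      by rewrite -(@ge0_integral_law _ _ _ _ _ (fun k => k%:R)%R).
    rewrite -(near fin_m2 n)//; rewrite unlock.
    by rewrite -(@ge0_integral_law _ _ _ _ _ (fun k => (k * (k - 1))%:R)%R).
  - move=> n e e0; have [eta eta0 Heta] := pgf_near1 (law (X n)) e0.
    exists eta => // u u01 ue; have := Heta u u01 ue.
    have /andP[u0 u1] := u01.
    have : (0 <= H n u <= 1)%R by apply: pgf_ge0_le1; apply/andP; split; lra.
    by rewrite -/(H n u) ler_norml => /andP[_ ?] ?; apply/andP; split; lra.
have mass_cvg k :
    mass (law (X n)) k @[n --> \oo] --> mass (poisson_prob lambda 0%N) k.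
  apply: cvg_mass_pgf => z /andP[z0 z1].
  have z01 : (0 <= 1 - z <= 1)%R by apply/andP; split; lra.
  have := H_cvg _ z01; rewrite -pgf_poisson// /H.
  by under eq_fun do rewrite subKr; rewrite subKr.
move=> f cf [M0 [_ fM0]].
have mf : measurable_fun setT f by exact: continuous_measurable_fun.
(* Boundedness only provides bounds strictly above [M0]. *)
have fM x : (`|f x| <= M0 + 1)%R by apply: fM0 => //; rewrite ltrDl.
rewrite /poissonR (bounded_integral_distribution _ mf fM).
(* Only the values of [f] at integers matter, which reduces the claim to laws on [nat]. *)
have lawE n : (\int[distribution P (natR R \o X n)]_x (f x)%:E) =
    (\int[law (X n)]_k f k%:R)%R%:E.
  rewrite (bounded_integral_distribution _ mf fM).
  have lawX := @bounded_integral_distribution _ _ _ P _ _ (X n)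
    (fun k => f k%:R)%R (M0 + 1)%R _ _.
  by congr _%:E; symmetry; apply: (congr1 fine (lawX _ _)).
under eq_fun do rewrite lawE.
apply: cvg_EFin; first exact: nearW.
apply: (cvg_Rintegral_mass (g := fun k => f k%:R) mass_cvg) => k.
exact: fM.
Unshelve. all: by end_near. Qed.
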